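(* For all integers $n\ge 0$, $m\ge j\ge 0$, $k,s\ge 1$, every prime $p\ge 3$, and every integer $r$ with $1\le r\le p-1$ such that $r$ is a quadratic non-residue modulo $p$ and $sk\equiv 1\pmod{p}$, we have \[\bar{b}^{k}_{p(m-j)+p-s,\;pm+s}(pn+r)\equiv 0\pmod{p}.\]
   Context: Write $f_m=\prod_{i\ge 1}(1-q^{mi})$ for $m\ge 1$, and $f_m^a$ for its $a$-th power. For integers $a,b,k\ge 1$, $\bar{b}^k_{a,b}(n)$ denotes the number of overcolored partition $k$-tuples of $n$: $k$-tuples of partitions of total weight $n$ in which each even part may appear in one of $a$ colors, each odd part may appear in one of $b$ colors, and the first occurrence of each part (of each color) in each component may be overlined. Equivalently, as formal power series in $q$, \[\sum_{n=0}^{\infty}\bar{b}^k_{a,b}(n)q^n=\frac{f_2^{(3b-2a)k}}{f_1^{2bk}f_4^{(b-a)k}}.\] If the index $a$ is not positive, $\bar{b}^k_{a,b}(n)$ is understood to be defined by this generating function. *)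

(* Defs.v *)
From HB Require Import structures.
From mathcomp Require Import all_boot all_order all_algebra.
From mathcomp Require Import boolp.

Set Implicit Arguments.
Unset Strict Implicit.
Unset Printing Implicit Defensive.

Import GRing.Theory.
Local Open Scope ring_scope.

(* Formal power series over a ring of coefficients. *)
Record fps (R : Type) := Fps { coef_fps : nat -> R }.

HB.instance Definition _ (R : Type) := gen_eqMixin (fps R).
HB.instance Definition _ (R : Type) := gen_choiceMixin (fps R).

Section FpsRing.

Variable R : comUnitRingType.
Implicit Types u v w : fps R.

Lemma fpsP u v : coef_fps u =1 coef_fps v <-> u = v.
Proof. by split=> [|->//]; case: u; case: v => f g /funext /= ->. Qed.

Definition fps0 : fps R := Fps (fun=> 0).
Definition fps1 : fps R := Fps (fun n => (n == 0%N)%:R).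
Definition fps_opp u := Fps (fun n => - coef_fps u n).
Definition fps_add u v := Fps (fun n => coef_fps u n + coef_fps v n).
Definition fps_mul u v :=
  Fps (fun n => \sum_(i < n.+1) coef_fps u i * coef_fps v (n - i)).

Lemma fps_addA : associative fps_add.
Proof. by move=> u v w; apply/fpsP => n /=; rewrite addrA. Qed.
Lemma fps_addC : commutative fps_add.
Proof. by move=> u v; apply/fpsP => n /=; rewrite addrC. Qed.
Lemma fps_add0 : left_id fps0 fps_add.
Proof. by move=> u; apply/fpsP => n /=; rewrite add0r. Qed.
Lemma fps_addN : left_inverse fps0 fps_opp fps_add.
Proof. by move=> u; apply/fpsP => n /=; rewrite addNr. Qed.

HB.instance Definition _ := GRing.isZmodule.Build (fps R)
  fps_addA fps_addC fps_add0 fps_addN.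

Lemma coef_fps_mul_trunc u v N n : (n < N)%N ->
  coef_fps (fps_mul u v) n =
    ((\poly_(i < N) coef_fps u i) * (\poly_(i < N) coef_fps v i))`_n.
Proof.
move=> ltnN; rewrite coefM /=; apply: eq_bigr => i _.
rewrite !coef_poly (leq_ltn_trans (leq_subr _ _) ltnN).
by rewrite (leq_ltn_trans _ ltnN) // -ltnS.
Qed.

Lemma fps_mulC : commutative fps_mul.
Proof.
by move=> u v; apply/fpsP => n; rewrite !(coef_fps_mul_trunc _ _ (ltnSn n)) mulrC.
Qed.

Lemma fps_mulA : associative fps_mul.
Proof.
move=> u v w; apply/fpsP => n.
pose T (x : fps R) : {poly R} := \poly_(i < n.+1) coef_fps x i.
transitivity ((T u * T v * T w)`_n).
  rewrite -mulrA coefM /=; apply: eq_bigr => i _.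
  rewrite coef_poly ltn_ord; congr (_ * _).
  by apply: coef_fps_mul_trunc; rewrite ltnS leq_subr.
rewrite coefM /=; apply: eq_bigr => i _.
rewrite coef_poly ltnS leq_subr; congr (_ * _).
by rewrite -coef_fps_mul_trunc.
Qed.

Lemma fps_mul1 : left_id fps1 fps_mul.
Proof.
move=> u; apply/fpsP => n /=.
rewrite big_ord_recl /= mul1r subn0 big1 ?addr0 // => i _.
by rewrite mul0r.
Qed.

Lemma fps_mulD : left_distributive fps_mul fps_add.
Proof.
move=> u v w; apply/fpsP => n /=.
by rewrite -big_split; apply: eq_bigr => i _; rewrite mulrDl.
Qed.

Lemma fps_1neq0 : fps1 != 0.
Proof.
by apply/eqP => /fpsP /(_ 0%N) /= /eqP; rewrite oner_eq0.
Qed.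

HB.instance Definition _ := GRing.Zmodule_isComNzRing.Build (fps R)
  fps_mulA fps_mulC fps_mul1 fps_mulD fps_1neq0.

(* A power series is invertible iff its constant coefficient is; the
   coefficients of the inverse v of u are then given by
   u_0 v_0 = 1 and u_0 v_(n+1) = - \sum_(j <= n) u_(n+1-j) v_j.
   [inv_upto u n] agrees with v on the coefficients 0, ..., n. *)
Fixpoint inv_upto u (n : nat) : nat -> R :=
  if n is n'.+1 then
    let v := inv_upto u n' in
    fun i => if (i <= n')%N then v i else
      - (coef_fps u 0)^-1 * \sum_(j < n) coef_fps u (n - j) * v j
  else fun=> (coef_fps u 0)^-1.

Definition fps_unit : {pred fps R} := fun u => coef_fps u 0 \is a GRing.unit.

Definition fps_inv u : fps R :=
  if u \in fps_unit then Fps (fun n => inv_upto u n n) else u.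

Lemma inv_uptoE u n i : (i <= n)%N -> inv_upto u n i = inv_upto u i i.
Proof.
elim: n => [|n IHn]; first by rewrite leqn0 => /eqP->.
by rewrite leq_eqVlt ltnS => /predU1P[->//|lein] /=; rewrite lein IHn.
Qed.

Lemma fps_mulVr : {in fps_unit, left_inverse 1 fps_inv *%R}.
Proof.
move=> u uU; apply/fpsP; rewrite /fps_inv uU.
case=> [|n] /=; first by rewrite big_ord1 mulVr.
rewrite big_ord_recr /= ltnn subnn mulrAC mulNr mulVr // mulN1r.
apply/eqP; rewrite subr_eq0; apply/eqP; apply: eq_bigr => i _.
by rewrite mulrC inv_uptoE // -ltnS.
Qed.

Lemma fps_unitPl u v : v * u = 1 -> u \in fps_unit.
Proof.
move=> /fpsP /(_ 0%N) /=; rewrite big_ord1 /= => vu1.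
by apply/unitrP; exists (coef_fps v 0); rewrite vu1 mulrC vu1.
Qed.

Lemma fps_invr_out : {in [predC fps_unit], fps_inv =1 id}.
Proof. by move=> u; rewrite inE /= /fps_inv => /negbTE ->. Qed.

HB.instance Definition _ := GRing.ComNzRing_hasMulInverse.Build (fps R)
  fps_mulVr fps_unitPl fps_invr_out.

End FpsRing.

(* f_m = \prod_(i >= 1) (1 - q^(m i)).  For m >= 1 the factors with i > n do
   not contribute to the coefficient of q^n. *)
Definition f_ (m : nat) : fps int :=
  Fps (fun n => (\prod_(1 <= i < n.+1) (1 - 'X^(m * i)%N) : {poly int})`_n).

(* The generating function of the overcolored partition k-tuples when a >= 1;
   it still makes sense, and serves as the definition, when a <= 0. *)
Definition overcolored_gf (k : nat) (a : int) (b : nat) : fps int :=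
  f_ 2 ^ ((3 * b%:Z - 2 * a) * k%:Z)
    / (f_ 1 ^ (2 * b%:Z * k%:Z) * f_ 4 ^ ((b%:Z - a) * k%:Z)).

Section OvercoloredTuples.

Variables (k a b n : nat).

(* A colored part x of size at most n: its size is (tag x).+1, and its color is
   one of a colors if the size is even, one of b colors if it is odd. *)
Definition colored_part : finType :=
  {d : 'I_n & 'I_(if odd d.+1 then b else a)}.

Definition part_size (x : colored_part) : nat := (tag x).+1.

(* t (i, x) is the multiplicity of the colored part x in the i-th component,
   paired with whether its first occurrence is overlined. *)
Definition overcolored_tuples :
    {set {ffun 'I_k * colored_part -> 'I_n.+1 * bool}} :=
  [set t : {ffun 'I_k * colored_part -> 'I_n.+1 * bool} |
    [forall ix, (t ix).2 ==> (0 < (t ix).1)%N] &&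
    (\sum_ix part_size ix.2 * (t ix).1 == n)%N].

End OvercoloredTuples.

Definition bbar (k : nat) (a : int) (b n : nat) : int :=
  if 0 < a then #|overcolored_tuples k `|a| b n|%:Z
  else coef_fps (overcolored_gf k a b) n.

(* Main.v *)
(* Put phi = f_2^5 / (f_1^2 f_4^2). Modulo p-th powers of power series, and
   because s k = 1 mod p, the generating function is phi times a p-th power.
   Coefficients of a p-th power at indices prime to p vanish mod p, and by
   Gauss phi is the theta series sum_x q^(x^2); so the coefficient at an
   exponent that is a non-residue mod p vanishes mod p.
   Only the support of phi matters. Since phi = f_2 prod_i (1 + q^(2i-1))^2, it
   is read off the finite identity
     prod_(i <= n) (1 + q^(2i-1))^2
       = sum_(|d| <= n) q^(d^2) [2n choose n+d]_(q^2),
   in which f_2 [2n choose n+d]_(q^2) tends to 1. *)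
Require Import Defs.
From mathcomp Require Import all_boot all_order all_algebra.
From mathcomp Require Import zify ring.

Set Implicit Arguments.
Unset Strict Implicit.
Unset Printing Implicit Defensive.

Import GRing.Theory.
Local Open Scope ring_scope.

(** * Coefficients of power series and powers of the variable *)

Lemma coef_fpsD (R : comUnitRingType) (u v : fps R) n :
  coef_fps (u + v) n = coef_fps u n + coef_fps v n.
Proof. by []. Qed.

Lemma coef_fpsN (R : comUnitRingType) (u : fps R) n :
  coef_fps (- u) n = - coef_fps u n.
Proof. by []. Qed.

Lemma coef_fpsM (R : comUnitRingType) (u v : fps R) n :
  coef_fps (u * v) n = \sum_(i < n.+1) coef_fps u i * coef_fps v (n - i).
Proof. by []. Qed.

Lemma coef_fps1 (R : comUnitRingType) n :
  coef_fps (1 : fps R) n = (n == 0%N)%:R.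
Proof. by []. Qed.

Lemma coef_fps_sum (R : comUnitRingType) (I : Type) (s : seq I) (P : pred I)
    (F : I -> fps R) n :
  coef_fps (\sum_(i <- s | P i) F i) n = \sum_(i <- s | P i) coef_fps (F i) n.
Proof. exact: (big_morph (fun u => coef_fps u n)). Qed.

Lemma coef_fpsMn (R : comUnitRingType) (u : fps R) c n :
  coef_fps (u *+ c) n = coef_fps u n *+ c.
Proof. by elim: c => // c IH; rewrite !mulrS coef_fpsD IH. Qed.

Definition fpsX (R : comUnitRingType) : fps R := Fps (fun n => (n == 1%N)%:R).
Arguments fpsX {R}.

Lemma coef_fpsXM (R : comUnitRingType) (u : fps R) n :
  coef_fps (fpsX * u) n = if n is n'.+1 then coef_fps u n' else 0.
Proof.
rewrite coef_fpsM big_ord_recl /= mul0r add0r.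
case: n => [|n]; first by rewrite big_ord0.
rewrite big_ord_recl /= mul1r subn1 big1 ?addr0 // => i _.
by rewrite mul0r.
Qed.

Lemma coef_fpsXnM (R : comUnitRingType) (u : fps R) k n :
  coef_fps (fpsX ^+ k * u) n = if (n < k)%N then 0 else coef_fps u (n - k).
Proof.
elim: k n => [|k IH] n; first by rewrite expr0 mul1r subn0.
by rewrite exprS -mulrA coef_fpsXM; case: n => [//|n]; rewrite IH ltnS subSS.
Qed.

Lemma coef_fpsXn (R : comUnitRingType) k n :
  coef_fps (fpsX ^+ k : fps R) n = (n == k)%:R.
Proof.
rewrite -[fpsX ^+ k]mulr1 coef_fpsXnM coef_fps1.
by case: ltngtP => // [lnk|->]; rewrite ?subnn // subn_eq0 leqNgt lnk.
Qed.

(** Allows an identity with negative powers of q to be proved after clearing them, without Laurent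
    series. *)
Lemma fpsXn_inj (R : comUnitRingType) k (u v : fps R) :
  fpsX ^+ k * u = fpsX ^+ k * v -> u = v.
Proof.
move=> /(congr1 (@coef_fps R)) E; apply/fpsP => n.
by have := congr1 (@^~ (n + k)%N) E; rewrite !coef_fpsXnM ltnNge leq_addl addnK.
Qed.

Definition fps_of_poly (R : comUnitRingType) (P : {poly R}) : fps R :=
  Fps (fun n => P`_n).

Lemma fps_of_poly_prod (R : comUnitRingType) (I : Type) (s : seq I)
    (F : I -> {poly R}) :
  fps_of_poly (\prod_(i <- s) F i) = \prod_(i <- s) fps_of_poly (F i).
Proof.
apply: (big_morph (@fps_of_poly R)) => [P Q|]; apply/fpsP => n.
  by rewrite coef_fpsM /= coefM.
by rewrite /= coef1.
Qed.

Lemma fps_of_poly_1subXn (R : comUnitRingType) k :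
  fps_of_poly (1 - 'X^k) = 1 - fpsX ^+ k :> fps R.
Proof.
by apply/fpsP => n; rewrite /= coefB coef1 coefXn coef_fpsXn.
Qed.

(** * Congruence modulo [q ^ N] *)

Definition eqm (R : comUnitRingType) N (u v : fps R) : Prop :=
  forall i, (i < N)%N -> coef_fps u i = coef_fps v i.

Lemma eqm_refl (R : comUnitRingType) N (u : fps R) : eqm N u u.
Proof. by []. Qed.

Lemma eqm_sym (R : comUnitRingType) N (u v : fps R) : eqm N u v -> eqm N v u.
Proof. by move=> E i /E. Qed.

Lemma eqm_trans (R : comUnitRingType) N (v u w : fps R) :
  eqm N u v -> eqm N v w -> eqm N u w.
Proof. by move=> E F i iN; rewrite E ?F. Qed.

Lemma eqmW (R : comUnitRingType) N M (u v : fps R) :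
  (N <= M)%N -> eqm M u v -> eqm N u v.
Proof. by move=> NM E i iN; apply: E; apply: leq_trans NM. Qed.

Lemma eqm_ext (R : comUnitRingType) (u v : fps R) :
  (forall N, eqm N u v) -> u = v.
Proof. by move=> E; apply/fpsP => n; apply: (E n.+1). Qed.

Lemma eqmM (R : comUnitRingType) N (u u' v v' : fps R) :
  eqm N u u' -> eqm N v v' -> eqm N (u * v) (u' * v').
Proof.
move=> E F n nN; rewrite !coef_fpsM; apply: eq_bigr => i _.
by rewrite E ?F //; apply: leq_ltn_trans nN; rewrite ?leq_subr // -ltnS.
Qed.

Lemma eqm_prod (R : comUnitRingType) (I : Type) (s : seq I) (P : pred I)
    (F G : I -> fps R) N :
  (forall i, P i -> eqm N (F i) (G i)) ->
  eqm N (\prod_(i <- s | P i) F i) (\prod_(i <- s | P i) G i).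
Proof. by move=> E; apply: (big_ind2 (eqm N)) => // *; apply: eqmM. Qed.

Lemma eqmX (R : comUnitRingType) N (u v : fps R) c :
  eqm N u v -> eqm N (u ^+ c) (v ^+ c).
Proof. by move=> E; elim: c => // c IH; rewrite !exprS; apply: eqmM. Qed.

Lemma eqm_unitI (R : comUnitRingType) N (u v w : fps R) :
  u \is a GRing.unit -> eqm N (u * v) (u * w) -> eqm N v w.
Proof. by move=> uU E; rewrite -[v](mulKr uU) -[w](mulKr uU); apply: eqmM. Qed.

Lemma eqm_unit (R : comUnitRingType) N (u v : fps R) :
  (0 < N)%N -> eqm N u v -> (u \is a GRing.unit) = (v \is a GRing.unit).
Proof.
by move=> N0 E; rewrite ![_ \is a _]/(coef_fps _ 0 \is a GRing.unit) E.
Qed.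

Lemma eqm_1subXn (R : comUnitRingType) k :
  eqm k (1 - fpsX ^+ k : fps R) 1.
Proof.
move=> i ik; rewrite coef_fpsD coef_fpsN coef_fpsXn.
by rewrite (ltn_eqF ik) subr0.
Qed.

Lemma eqm_1addXn (R : comUnitRingType) k :
  eqm k (1 + fpsX ^+ k : fps R) 1.
Proof.
by move=> i ik; rewrite coef_fpsD coef_fpsXn (ltn_eqF ik) addr0.
Qed.

Lemma unit_1subXn (R : comUnitRingType) k :
  (0 < k)%N -> (1 - fpsX ^+ k : fps R) \is a GRing.unit.
Proof. by move=> k0; rewrite (eqm_unit k0 (@eqm_1subXn _ _)) unitr1. Qed.

(** * Infinite products *)

(** Coefficient n is read off the first n factors. This is the true infinite product once [F i] is 1
    modulo q^i, the hypothesis carried by the lemmas below. *)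
Definition iprod (R : comUnitRingType) (F : nat -> fps R) : fps R :=
  Fps (fun n => coef_fps (\prod_(1 <= i < n.+1) F i) n).

Lemma eqm_iprod (R : comUnitRingType) (F : nat -> fps R) N M :
  (forall i, eqm i (F i) 1) -> (N <= M)%N ->
  eqm N (iprod F) (\prod_(1 <= i < M) F i).
Proof.
move=> F1 NM i iN /=; rewrite [in RHS](big_cat_nat (n := i.+1)) //=; last lia.
suff : eqm i.+1 (\prod_(i.+1 <= j < M) F j) 1.
  move=> /(eqmM (@eqm_refl _ _ (\prod_(1 <= j < i.+1) F j)))/(_ i (ltnSn i)).
  by rewrite mulr1.
rewrite big_seq; apply: (big_ind (fun u => eqm i.+1 u 1)) => [//|u v u1 v1|j].
  by rewrite -[1]mulr1; apply: eqmM.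
by rewrite mem_index_iota => /andP[ij _]; apply: eqmW (F1 j).
Qed.

Lemma eq_iprod (R : comUnitRingType) (F G : nat -> fps R) :
  (forall i, (0 < i)%N -> F i = G i) -> iprod F = iprod G.
Proof.
move=> E; apply/fpsP => n /=; congr (coef_fps _ _).
by apply: eq_big_nat => i /andP[i0 _]; apply: E.
Qed.

Lemma iprodM (R : comUnitRingType) (F G : nat -> fps R) :
  (forall i, eqm i (F i) 1) -> (forall i, eqm i (G i) 1) ->
  iprod (fun i => F i * G i) = iprod F * iprod G.
Proof.
move=> F1 G1; apply: eqm_ext => N.
have FG1 i : eqm i (F i * G i) 1 by rewrite -[1]mulr1; apply: eqmM.
apply: eqm_trans (eqm_iprod FG1 (leqnn N)) _; rewrite big_split /=.
by apply/eqm_sym/eqmM; apply: eqm_iprod.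
Qed.

Lemma iprodX (R : comUnitRingType) (F : nat -> fps R) c :
  (forall i, eqm i (F i) 1) -> iprod (fun i => F i ^+ c) = iprod F ^+ c.
Proof.
move=> F1; apply: eqm_ext => N.
have Fc1 i : eqm i (F i ^+ c) 1 by rewrite -(expr1n _ c); apply: eqmX.
apply: eqm_trans (eqm_iprod Fc1 (leqnn N)) _; rewrite prodrXl.
by apply/eqm_sym/eqmX/eqm_iprod.
Qed.

Lemma iprod_odd_even (R : comUnitRingType) (F : nat -> fps R) :
  (forall i, eqm i (F i) 1) ->
  iprod F = iprod (fun i => F (2 * i).-1) * iprod (fun i => F (2 * i)%N).
Proof.
move=> F1; apply: eqm_ext => N.
have Fo1 i : eqm i (F (2 * i).-1) 1 by apply: eqmW (F1 _); lia.
have Fe1 i : eqm i (F (2 * i)%N) 1 by apply: eqmW (F1 _); lia.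
have le1 : (N <= (2 * N).+1)%N by lia.
apply: eqm_trans (eqm_iprod F1 le1) _.
have -> : \prod_(1 <= i < (2 * N).+1) F i =
    \prod_(1 <= i < N.+1) F (2 * i).-1 * \prod_(1 <= i < N.+1) F (2 * i)%N.
  elim: N {le1} => [|N IH]; first by rewrite !big_geq ?mulr1.
  have [E e] : (2 * N.+1 = (2 * N).+2)%N /\ (2 * N.+1).-1 = (2 * N).+1 by lia.
  rewrite [in LHS]E.
  rewrite 2?big_nat_recr //= IH.
  rewrite [in RHS]big_nat_recr // [X in _ = _ * X]big_nat_recr // e E.
  by rewrite -mulrA mulrACA.
by apply/eqm_sym/eqmM; apply: eqm_iprod.
Qed.

(** The constant coefficient is that of an empty product, hence 1 for every [F]. *)
Lemma iprod_unit (R : comUnitRingType) (F : nat -> fps R) :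
  iprod F \is a GRing.unit.
Proof.
rewrite [_ \is a _]/(coef_fps _ 0 \is a GRing.unit) /= big_geq //=.
exact: unitr1.
Qed.

Lemma f_E m : f_ m = iprod (fun i => 1 - fpsX ^+ (m * i)).
Proof.
apply/fpsP => n /=.
under [in RHS]eq_bigr do rewrite -fps_of_poly_1subXn.
by rewrite -fps_of_poly_prod.
Qed.

Lemma f_unit m : f_ m \is a GRing.unit.
Proof. by rewrite f_E iprod_unit. Qed.

Lemma eqm_f_factor (R : comUnitRingType) m i : (0 < m)%N ->
  eqm i (1 - fpsX ^+ (m * i) : fps R) 1.
Proof. by move=> m0; apply: eqmW (@eqm_1subXn _ _); rewrite leq_pmull. Qed.

(** * Products over odd exponents *)

(** In Pochhammer notation, [odd_minus] is (q; q^2)_oo and [odd_plus] is (-q; q^2)_oo. *)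
Definition odd_minus : fps int := iprod (fun i => 1 - fpsX ^+ (2 * i).-1).
Definition odd_plus : fps int := iprod (fun i => 1 + fpsX ^+ (2 * i).-1).

Lemma eqm_odd_minus_factor (R : comUnitRingType) i :
  eqm i (1 - fpsX ^+ (2 * i).-1 : fps R) 1.
Proof. by apply: eqmW (@eqm_1subXn _ _); lia. Qed.

Lemma eqm_odd_plus_factor (R : comUnitRingType) i :
  eqm i (1 + fpsX ^+ (2 * i).-1 : fps R) 1.
Proof. by apply: eqmW (@eqm_1addXn _ _); lia. Qed.

Lemma f1E : f_ 1 = odd_minus * f_ 2.
Proof.
rewrite !f_E iprod_odd_even; last by move=> i; apply: eqm_f_factor.
by congr (_ * _); apply: eq_iprod => i _; rewrite mul1n.
Qed.

Lemma f2E : f_ 2 = odd_minus * odd_plus * f_ 4.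
Proof.
rewrite !f_E iprod_odd_even; last by move=> i; apply: eqm_f_factor.
congr (_ * _); last by apply: eq_iprod => i _; rewrite mulnA.
rewrite -iprodM; [|exact: eqm_odd_minus_factor|exact: eqm_odd_plus_factor].
(* Difference of squares: 1 - q^(2(2i-1)) = (1 - q^(2i-1)) (1 + q^(2i-1)). *)
by apply: eq_iprod => i _; rewrite mulnC exprM; ring.
Qed.

(** * The homogeneous [q]-binomial theorem *)

Fixpoint qbin (R : comNzRingType) (Q : R) (n k : nat) : R :=
  match n, k with
  | _, 0%N => 1
  | 0%N, _.+1 => 0
  | n'.+1, k'.+1 => qbin Q n' k'.+1 + Q ^+ (n' - k') * qbin Q n' k'
  end.

Definition qpoch (R : comNzRingType) (Q : R) (n : nat) : R :=
  \prod_(1 <= i < n.+1) (1 - Q ^+ i).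

Lemma qbin_small (R : comNzRingType) (Q : R) n k : (n < k)%N -> qbin Q n k = 0.
Proof.
elim: n k => [|n IH] [|k] //= nk.
by rewrite !IH ?mulr0 ?addr0 //; lia.
Qed.

Lemma qbin0 (R : comNzRingType) (Q : R) n : qbin Q n 0 = 1.
Proof. by case: n. Qed.

Lemma qpochS (R : comNzRingType) (Q : R) n :
  qpoch Q n.+1 = qpoch Q n * (1 - Q ^+ n.+1).
Proof. by rewrite /qpoch big_nat_recr. Qed.

(** The quotient formula for Gaussian binomials, cleared of denominators; induction on a + b. *)
Lemma qbin_qpoch (R : comNzRingType) (Q : R) a b :
  qpoch Q a * qpoch Q b * qbin Q (a + b) a = qpoch Q (a + b).
Proof.
have q0 : qpoch Q 0 = 1 by rewrite /qpoch big_geq.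
move: {2}(a + b)%N (erefl (a + b)%N) => N; elim: N a b => [|N IH] [|a] [|b] //= E;
  rewrite ?q0 ?add0n ?qbin0 ?mul1r ?mulr1 //.
- rewrite addn0 /= qbin_small // add0r subnn mul1r.
  have := IH a 0%N; rewrite addn0 q0 mulr1 => IHa.
  by rewrite qpochS mulrAC IHa ?addn0 ?qpochS //; lia.
have -> : (a + b.+1 - a = b.+1)%N by lia.
have IH1 := IH a b.+1 ltac:(lia); have IH2 := IH a.+1 b ltac:(lia).
rewrite addSnnS in IH2.
rewrite addSn (qpochS _ (a + b.+1)).
(* Each Pascal term becomes an induction hypothesis times a weight, and the weights add up: (1 -
   Q^(b+1)) + Q^(b+1) (1 - Q^(a+1)) = 1 - Q^(a+b+2). *)
transitivity (qpoch Q a.+1 * qpoch Q b * qbin Q (a + b.+1) a.+1 * (1 - Q ^+ b.+1)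
  + Q ^+ b.+1 * (1 - Q ^+ a.+1) * (qpoch Q a * qpoch Q b.+1 * qbin Q (a + b.+1) a)).
  by rewrite (qpochS _ b) (qpochS _ a); ring.
have -> : (a + b.+1).+1 = (b.+1 + a.+1)%N by lia.
by rewrite IH1 IH2 exprD; ring.
Qed.

(** The second variable y makes it possible to set y = q^(2n) later, where the one-variable form
    would need x to be a negative power of q. *)
Lemma qbinomial (R : comNzRingType) (Q x y : R) n :
  \prod_(i < n) (y + x * Q ^+ i) =
  \sum_(k < n.+1) Q ^+ 'C(k, 2) * qbin Q n k * x ^+ k * y ^+ (n - k).
Proof.
elim: n => [|n IH]; first by rewrite big_ord0 big_ord_recl big_ord0 /=; ring.
rewrite big_ord_recr /= IH mulrDr big_distrl [X in _ + X]big_distrl /=.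
rewrite [in RHS]big_ord_recl /= bin0n expr0.
rewrite big_ord_recl /= bin0n expr0 qbin0.
(* Pascal's rule splits the term of index k+1: the first half comes from the summand y of the last
   factor, the second from x Q^n. *)
rewrite -[X in _ = _ + X](@eq_bigr _ _ _ _ _ _
  (fun k : 'I_n.+1 => Q ^+ 'C(k.+1, 2) * qbin Q n k.+1 * x ^+ k.+1 * y ^+ (n - k)
   + Q ^+ 'C(k, 2) * qbin Q n k * x ^+ k * y ^+ (n - k) * (x * Q ^+ n))); last first.
  move=> k _; rewrite /bump /= add1n subSS binS bin1 [x ^+ k.+1]exprS.
  have -> : Q ^+ n = Q ^+ (n - k) * Q ^+ k.
    by rewrite -exprD subnK // -ltnS.
  by rewrite exprD; ring.
rewrite big_split /= addrA; congr (_ + _).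
rewrite [in RHS]big_ord_recr /= qbin_small // !subn0 exprSr.
rewrite mulr0 !mul0r addr0; congr (_ + _); first by ring.
apply: eq_bigr => i _; rewrite /bump /= add1n.
have -> : (n - i = (n - i.+1).+1)%N by have := ltn_ord i; lia.
by rewrite [y ^+ _.+1]exprSr mulrA.
Qed.

(** * The theta series is supported on squares *)

Lemma finite_gauss n :
  \prod_(1 <= i < n.+1) (1 + fpsX ^+ (2 * i).-1 : fps int) ^+ 2 =
  \sum_(k < (2 * n).+1) fpsX ^+ (`|k%:Z - n%:Z| ^ 2)%N
     * qbin (fpsX ^+ 2) (2 * n) k.
Proof.
(* The q-binomial theorem with 2n factors, x = q, y = q^(2n) and Q = q^2 gives the identity times
   q^(3n^2). *)
apply: (@fpsXn_inj _ (3 * n ^ 2)).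
pose q : fps int := fpsX.
transitivity (\prod_(i < 2 * n) (q ^+ (2 * n) + q * (q ^+ 2) ^+ i)).
  rewrite mul2n -addnn.
  rewrite big_split_ord /=.
  (* In the lower half q^(2i+1) comes out of each factor, n^2 in total; reversing the index restores
     the order. *)
  have -> : \prod_(i < n) (q ^+ (n + n) + q * (q ^+ 2) ^+ i) =
     q ^+ (n ^ 2) * \prod_(1 <= i < n.+1) (1 + q ^+ (2 * i).-1).
    rewrite big_add1 /= big_mkord.
    rewrite [X in _ * X](reindex_inj rev_ord_inj) /=.
    have -> : q ^+ (n ^ 2) = \prod_(i < n) q ^+ (2 * i).+1.
      rewrite -expr_sum; congr (_ ^+ _).
      elim: (n) => [|j IH]; first by rewrite big_ord0.
      by rewrite big_ord_recr /= -IH; lia.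
    rewrite -big_split /=; apply: eq_bigr => i _.
    rewrite mulrDr mulr1 addrC -exprM -exprS -exprD.
    by congr (_ + _ ^+ _); have := ltn_ord i; lia.
  (* In the upper half q^(2n) comes out of each of the n factors. *)
  have -> : \prod_(i < n) (q ^+ (n + n) + q * (q ^+ 2) ^+ (n + i)) =
     q ^+ (2 * n ^ 2) * \prod_(1 <= i < n.+1) (1 + q ^+ (2 * i).-1).
    rewrite big_add1 /= big_mkord.
    have -> : q ^+ (2 * n ^ 2) = \prod_(i < n) q ^+ (n + n).
      by rewrite prodr_const card_ord -exprM; congr (_ ^+ _); lia.
    rewrite -big_split /=; apply: eq_bigr => i _.
    rewrite mulrDr mulr1 -exprM -exprS -exprD.
    by congr (_ + _ ^+ _); lia.
  rewrite prodrXl -/q (_ : (3 * n ^ 2 = n ^ 2 + 2 * n ^ 2)%N); last by lia.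
  by rewrite exprD; ring.
rewrite qbinomial big_distrr /=; apply: eq_bigr => k _.
rewrite -/q -!exprM.
(* Completing the square: k^2 - 2nk + 4n^2 = 3n^2 + (k - n)^2. *)
have E : (2 * 'C(k, 2) + k + 2 * n * (2 * n - k) =
          3 * n ^ 2 + `|k%:Z - n%:Z| ^ 2)%N.
  rewrite -mul_bin_diag bin1; case: k => k /= k2n.
  have -> : (k * k.-1 + k = k * k)%N by case: (k) => //= a; rewrite mulnS mulSn; lia.
  have [kn|/ltnW nk] := leqP k n.
    have -> : `|k%:Z - n%:Z|%N = (n - k)%N by lia.
    have [d ->] : exists d, n = (k + d)%N by exists (n - k)%N; lia.
    have -> : (2 * (k + d) - k = k + 2 * d)%N by lia.
    by rewrite addKn; nia.
  have -> : `|k%:Z - n%:Z|%N = (k - n)%N by lia.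
  have [d e] : exists d, k = (n + d)%N by exists (k - n)%N; lia.
  have [c e'] : exists c, n = (d + c)%N by exists (n - d)%N; lia.
  have [-> ->] : (2 * n - k = c /\ k - n = d)%N by lia.
  by rewrite e e'; nia.
by rewrite mulrA -exprD -E !exprD; ring.
Qed.

Lemma qpoch_unit e k : (0 < e)%N ->
  qpoch (fpsX ^+ e : fps int) k \is a GRing.unit.
Proof.
move=> Q0; rewrite /qpoch big_add1; elim/big_rec: _ => [|i u _ uU].
  exact: unitr1.
by rewrite unitrMl // -exprM unit_1subXn // muln_gt0 Q0.
Qed.

(** Every factor of index above N is 1 modulo q^(2(N+1)). *)
Lemma eqm_qpoch N a b : (N <= a)%N -> (N <= b)%N ->
  eqm (2 * N.+1) (qpoch (fpsX ^+ 2 : fps int) a) (qpoch (fpsX ^+ 2) b).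
Proof.
suff H c : (N <= c)%N ->
    eqm (2 * N.+1) (qpoch (fpsX ^+ 2 : fps int) c) (qpoch (fpsX ^+ 2) N).
  by move=> /H Ha /H Hb; apply: eqm_trans Ha (eqm_sym Hb).
elim: c => [|c IH]; first by rewrite leqn0 => /eqP ->.
rewrite leq_eqVlt => /predU1P[->//|Nc]; rewrite qpochS -[X in eqm _ _ X]mulr1.
apply: eqmM; first exact: IH.
by rewrite -exprM; apply: eqmW (@eqm_1subXn _ _); lia.
Qed.

(** Multiplying by (Q)_k (Q)_(2n-k) turns the claim into (Q)_n (Q)_(2n) = (Q)_k (Q)_(2n-k) modulo
    q^(2(N+1)), and all four indices are at least N. *)
Lemma eqm_qbin_qpoch n k N : (k <= 2 * n)%N -> (N <= k)%N -> (N <= 2 * n - k)%N ->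
  eqm (2 * N.+1) (qpoch (fpsX ^+ 2 : fps int) n * qbin (fpsX ^+ 2) (2 * n) k) 1.
Proof.
move=> kn Nk Nk'; set Q : fps int := fpsX ^+ 2.
have U : qpoch Q k * qpoch Q (2 * n - k) \is a GRing.unit.
  by rewrite unitrMl !qpoch_unit.
apply: (eqm_unitI U).
have := qbin_qpoch Q k (2 * n - k); rewrite subnKC // => E.
rewrite mulrCA E mulr1 mulrC.
have [Nn N2] : (N <= n)%N /\ (N <= 2 * n)%N by split; lia.
by apply: eqmM; apply: eqm_qpoch.
Qed.

Lemma theta_support N :
  (forall x, N <> x ^ 2)%N -> coef_fps (f_ 2 * odd_plus ^+ 2) N = 0.
Proof.
move=> nsq.
(* Modulo q^(N+1) both infinite products may be cut after N factors, which brings in [finite_gauss]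
   with n = N. *)
have -> : coef_fps (f_ 2 * odd_plus ^+ 2) N =
  coef_fps (qpoch (fpsX ^+ 2) N *
    \prod_(1 <= i < N.+1) (1 + fpsX ^+ (2 * i).-1) ^+ 2) N.
  apply: (@eqmM _ N.+1) => //.
    rewrite f_E /qpoch.
    under [X in eqm _ _ X]eq_bigr do rewrite -exprM.
    by apply: eqm_iprod => // i; apply: eqm_f_factor.
  rewrite prodrXl; apply: eqmX; apply: eqm_iprod => // i.
  exact: eqm_odd_plus_factor.
rewrite finite_gauss mulr_sumr coef_fps_sum big1 // => k _.
rewrite mulrCA coef_fpsXnM; case: ltnP => // dN.
set d := `|_|%N in dN *.
have kn := ltn_ord k.
(* With d = |k - N|, the cofactor of q^(d^2) is 1 modulo q^(2(N-d+1)), and N - d^2 lies below that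
   bound. So the term only counts if N = d^2. *)
rewrite (@eqm_qbin_qpoch N k (N - d)); try by rewrite /d; lia.
  rewrite coef_fps1; case: eqP => // e; case: (nsq d); lia.
nia.
Qed.

(** * Coefficients of [p]-th powers *)

(** The derivation q d/dq, which unlike d/dq does not shift indices. *)
Definition fps_euler (R : comUnitRingType) (u : fps R) : fps R :=
  Fps (fun n => coef_fps u n *+ n).

Lemma fps_eulerM (R : comUnitRingType) (u v : fps R) :
  fps_euler (u * v) = fps_euler u * v + u * fps_euler v.
Proof.
apply/fpsP => n; rewrite coef_fpsD !coef_fpsM /= -sumrMnl -big_split /=.
apply: eq_bigr => i _; rewrite mulrnAl mulrnAr -mulrnDr subnKC //.
by rewrite -ltnS.
Qed.

Lemma fps_eulerX (R : comUnitRingType) (u : fps R) c :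
  fps_euler (u ^+ c) = u ^+ c.-1 * fps_euler u *+ c.
Proof.
elim: c => [|c IH].
  by apply/fpsP => -[|n]; rewrite /= ?mul0rn.
rewrite exprS fps_eulerM IH; case: c {IH} => [|c] /=; first by ring.
by rewrite mulrnAr mulrA -exprS [X in X + _]mulrC -mulrS.
Qed.

(** Applying q d/dq to u^p multiplies the coefficient by l and yields a multiple of p; l is prime to
    p. *)
Lemma coef_fps_expp (u : fps int) p l :
  prime p -> ~~ (p %| l)%N -> (p %| coef_fps (u ^+ p) l)%Z.
Proof.
move=> pr pl; have : coef_fps (fps_euler (u ^+ p)) l =
  coef_fps (u ^+ p.-1 * fps_euler u *+ p) l by rewrite fps_eulerX.
rewrite coef_fpsMn /= => E.
have : (p %| coef_fps (u ^+ p) l * l%:Z)%Z.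
  by rewrite -mulr_natr natz in E; rewrite E -mulr_natr natz dvdz_mull.
by rewrite Gauss_dvdzl // coprimezE /= prime_coprime.
Qed.

(** * The generating function as a product *)

Lemma exprMz (R : comUnitRingType) (x y : R) (c : int) :
  x \is a GRing.unit -> y \is a GRing.unit -> (x * y) ^ c = x ^ c * y ^ c.
Proof. by move=> xU yU; rewrite exprMz_comm //; apply: mulrC. Qed.

(* [f_ 1], [f_ 2] and the products of overpartition factors are all Laurent
   monomials in the units [odd_minus], [odd_plus] and [f_ 4], so identities
   between them reduce to identities between exponents. *)
Definition qmono (a b c : int) : fps int :=
  odd_minus ^ a * odd_plus ^ b * f_ 4 ^ c.

Lemma odd_minus_unit : odd_minus \is a GRing.unit.
Proof. exact: iprod_unit. Qed.

Lemma odd_plus_unit : odd_plus \is a GRing.unit.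
Proof. exact: iprod_unit. Qed.

Definition qmono_unit := (odd_minus_unit, odd_plus_unit, f_unit, unitrXz, unitrMl).

Lemma qmonoM a b c a' b' c' :
  qmono a b c * qmono a' b' c' = qmono (a + a') (b + b') (c + c').
Proof.
by rewrite /qmono !exprzDr ?qmono_unit // mulrACA [in LHS](mulrACA (_ ^ a)).
Qed.

Lemma qmonoX a b c e : qmono a b c ^ e = qmono (a * e) (b * e) (c * e).
Proof. by rewrite /qmono !exprMz ?qmono_unit // !exprz_exp. Qed.

Lemma qmonoV a b c : (qmono a b c)^-1 = qmono (- a) (- b) (- c).
Proof. by rewrite -[_^-1]expr1z exprz_inv qmonoX !mulrN1. Qed.

Lemma odd_minus_qmono : odd_minus = qmono 1 0 0.
Proof. by rewrite /qmono expr1z !expr0z !mulr1. Qed.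

Lemma odd_plus_qmono : odd_plus = qmono 0 1 0.
Proof. by rewrite /qmono expr1z !expr0z mul1r mulr1. Qed.

Lemma f4_qmono : f_ 4 = qmono 0 0 1.
Proof. by rewrite /qmono expr1z !expr0z !mul1r. Qed.

Lemma f2_qmono : f_ 2 = qmono 1 1 1.
Proof. by rewrite f2E /qmono !expr1z. Qed.

Lemma f1_qmono : f_ 1 = qmono 2 1 1.
Proof. by rewrite f1E f2_qmono {1}odd_minus_qmono qmonoM. Qed.

Lemma overcolored_gfE k (a : int) b :
  overcolored_gf k a b =
    qmono (- (b%:Z + 2 * a) * k%:Z) ((b%:Z - 2 * a) * k%:Z) (- a * k%:Z).
Proof.
rewrite /overcolored_gf f1_qmono f2_qmono f4_qmono !qmonoX qmonoM qmonoV qmonoM.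
by congr (qmono _ _ _); ring.
Qed.

(** The series 1 + 2q^i + 2q^(2i) + ... of one colored part of size i in one component: each
    positive multiplicity counts twice, with and without overline. *)
Definition overfactor (i : nat) : fps int :=
  (1 + fpsX ^+ i) * (1 - fpsX ^+ i)^-1.

Lemma overfactorK i : (0 < i)%N ->
  overfactor i * (1 - fpsX ^+ i) = 1 + fpsX ^+ i.
Proof. by move=> i0; rewrite /overfactor mulrVK // unit_1subXn. Qed.

Lemma eqm_overfactor i : eqm i (overfactor i) 1.
Proof.
case: i => // i; apply: (eqm_unitI (unit_1subXn _ (ltn0Sn i))).
rewrite mulrC overfactorK // mulr1; apply: eqm_trans (@eqm_1addXn _ _) _.
exact/eqm_sym/eqm_1subXn.
Qed.

Lemma iprod_overfactor_odd :
  iprod (fun i => overfactor (2 * i).-1) * odd_minus = odd_plus.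
Proof.
rewrite -iprodM => [||i]; last exact: eqm_odd_minus_factor.
  by apply: eq_iprod => i i0; rewrite overfactorK //; lia.
by move=> i; apply: eqmW (@eqm_overfactor _); lia.
Qed.

Lemma iprod_overfactor_even :
  iprod (fun i => overfactor (2 * i)) * f_ 2 ^+ 2 = f_ 4.
Proof.
have F1 i : eqm i (1 - fpsX ^+ (2 * i) : fps int) 1 by apply: eqm_f_factor.
have G1 i : eqm i (overfactor (2 * i)) 1.
  by apply: eqmW (@eqm_overfactor _); lia.
have FG1 i : eqm i (overfactor (2 * i) * (1 - fpsX ^+ (2 * i))) 1.
  by have := eqmM (G1 i) (F1 i); rewrite mulr1.
rewrite expr2 mulrA !f_E -!iprodM //.
apply: eq_iprod => i i0; rewrite overfactorK; last lia.
have -> : (4 * i = 2 * i * 2)%N by lia.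
by rewrite [in RHS]exprM; move: (fpsX ^+ (2 * i)) => y; ring.
Qed.

Lemma overcolored_gf_iprod k (a b : nat) :
  iprod (fun i => overfactor i ^+ ((if odd i then b else a) * k)) =
    overcolored_gf k a b.
Proof.
rewrite iprod_odd_even; last first.
  move=> i; rewrite -(expr1n _ ((if odd i then b else a) * k)).
  exact/eqmX/eqm_overfactor.
rewrite (@eq_iprod _ _ (fun i => overfactor (2 * i).-1 ^+ (b * k))); last first.
  by move=> i i0; rewrite (_ : odd _ = true) //; lia.
rewrite [X in _ * X](@eq_iprod _ _ (fun i => overfactor (2 * i)%N ^+ (a * k)));
  last first.
  by move=> i i0; rewrite (_ : odd _ = false) //; lia.
rewrite !iprodX; try by move=> i; apply: eqmW (@eqm_overfactor _); lia.
(* Odd sizes contribute [odd_plus] / [odd_minus], and even sizes f_4 / f_2^2. *)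
have -> : iprod (fun i => overfactor (2 * i).-1) = qmono (- 1) 1 0.
  rewrite -[LHS](mulrK odd_minus_unit) iprod_overfactor_odd.
  by rewrite odd_minus_qmono odd_plus_qmono qmonoV qmonoM.
have -> : iprod (fun i => overfactor (2 * i)) = qmono (- 2) (- 2) (- 1).
  have f22 : f_ 2 ^+ 2 \is a GRing.unit by rewrite unitrX ?f_unit.
  rewrite -[LHS](mulrK f22) iprod_overfactor_even f2_qmono exprnP qmonoX.
  by rewrite f4_qmono qmonoV qmonoM.
rewrite overcolored_gfE !exprnP !qmonoX qmonoM !PoszM.
by congr (qmono _ _ _); ring.
Qed.

(** * Counting overcolored tuples *)

(** [overfactor] with multiplicities cut off at n; the indicator forbids overlining an absent
    part. *)
Definition part_gf n d : fps int :=
  \sum_(t : 'I_n.+1 * bool) (t.2 ==> (0 < t.1)%N)%:R * fpsX ^+ (d * t.1).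

Lemma part_gfE n d :
  (1 - fpsX ^+ d) * part_gf n d = 1 + fpsX ^+ d - fpsX ^+ (d * n.+1) *+ 2.
Proof.
rewrite /part_gf -(pair_bigA _ (fun (c : 'I_n.+1) (o : bool) =>
  (o ==> (0 < c)%N)%:R * fpsX ^+ (d * c))) /=.
rewrite big_ord_recl /= big_bool /= muln0 expr0 mul0r mul1r add0r.
under eq_bigr do rewrite big_bool /= !mul1r /bump /= add1n.
elim: n => [|n IH]; first by rewrite big_ord0 muln1; ring.
by rewrite big_ord_recr /= (addrA 1) mulrDr IH (mulnS d n.+1) exprD; ring.
Qed.

Lemma eqm_part_gf n d : (0 < d)%N -> eqm n.+1 (part_gf n d) (overfactor d).
Proof.
move=> d0; apply: (eqm_unitI (unit_1subXn _ d0)).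
rewrite part_gfE [X in eqm _ _ X]mulrC overfactorK // => i iN.
rewrite coef_fpsD coef_fpsN coef_fpsMn coef_fpsXn ltn_eqF ?mul0rn ?subr0 //.
by apply: leq_trans iN _; rewrite leq_pmull.
Qed.

(** Distributivity expands the product over all functions t; each yields q to its weight, or 0 if it
    overlines an absent part. *)
Lemma card_overcolored_tuples k a b n :
  #|overcolored_tuples k a b n|%:Z =
  coef_fps (\prod_(ix : 'I_k * colored_part a b n) part_gf n (part_size ix.2)) n.
Proof.
rewrite bigA_distr_bigA coef_fps_sum -sum1_card -natz natr_sum big_mkcond /=.
apply: eq_bigr => t _; rewrite inE.
set V := [forall ix, _].
rewrite (_ : \prod_ix _ =
  V%:R * fpsX ^+ (\sum_ix part_size ix.2 * (t ix).1)%N); last first.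
  rewrite big_split /= -expr_sum -natr_prod; congr (_%:R * _).
  rewrite /V; case: forallP => [H|/forallP].
    by rewrite big1 // => ix _; rewrite H.
  rewrite negb_forall => /existsP[ix /negbTE H].
  by rewrite (bigD1 ix) //= H mul0n.
rewrite mulr_natl coef_fpsMn coef_fpsXn eq_sym.
by case: V => //=; case: eqP.
Qed.

Lemma prod_colored_part k a b n (G : nat -> fps int) :
  \prod_(ix : 'I_k * colored_part a b n) G (part_size ix.2) =
  \prod_(1 <= i < n.+1) G i ^+ ((if odd i then b else a) * k).
Proof.
rewrite -(pair_bigA _ (fun _ x => G (part_size x))) /= prodr_const card_ord.
rewrite big_add1 /= big_mkord -prodrXl.
rewrite -(@sig_big_dep _ _ _ _ (fun d : 'I_n => 'I_(if odd d.+1 then b else a))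
  xpredT (fun _ => xpredT) (fun d _ => G d.+1 ^+ k)) /=.
by apply: eq_bigr => d _; rewrite prodr_const card_ord -exprM mulnC.
Qed.

(** For positive a, the cutoffs at n on sizes and multiplicities do not affect the coefficient of
    q^n. *)
Lemma bbar_gf k (a : int) b n : bbar k a b n = coef_fps (overcolored_gf k a b) n.
Proof.
rewrite /bbar; case: ifP => // a0.
rewrite card_overcolored_tuples prod_colored_part.
have -> : overcolored_gf k a b = overcolored_gf k `|a|%N b.
  by rewrite gtz0_abs.
rewrite -overcolored_gf_iprod.
have H i : eqm i (overfactor i ^+ ((if odd i then b else `|a|%N) * k)) 1.
  rewrite -(expr1n _ ((if odd i then b else `|a|%N) * k)).
  exact/eqmX/eqm_overfactor.
rewrite (eqm_iprod H (leqnn n.+1)) //.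
rewrite big_nat_cond [in RHS]big_nat_cond.
apply: (@eqm_prod _ _ _ _ _ _ n.+1) => // i /andP[/andP[i0 _] _].
exact/eqmX/eqm_part_gf.
Qed.

(** * The congruence *)

Lemma overcolored_gf_theta (k p m j s t : nat) : (s * k = t * p + 1)%N ->
  exists H : fps int,
    overcolored_gf k (p%:Z * (m%:Z - j%:Z) + p%:Z - s%:Z) (p * m + s) =
    (f_ 2 * odd_plus ^+ 2) * H ^+ p.
Proof.
move=> /(congr1 Posz); rewrite PoszD !PoszM => E.
pose c := m%:Z - j%:Z + 1.
(* With a = pc - s and b = pm + s, subtract the exponents (1, 3, 1) of the theta factor from those
   of the generating function, substitute sk = tp + 1 and divide by p. *)
exists (qmono (t%:Z - k%:Z * (m%:Z + 2 * c)) (3 * t%:Z + k%:Z * (m%:Z - 2 * c))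
  (t%:Z - k%:Z * c)).
rewrite overcolored_gfE f2_qmono odd_plus_qmono !exprnP !qmonoX !qmonoM.
rewrite PoszD PoszM; congr (qmono _ _ _).
- transitivity (s%:Z * k%:Z - p%:Z * k%:Z * (m%:Z + 2 * c));
    first by rewrite /c; ring.
  by rewrite E; ring.
- transitivity (3 * (s%:Z * k%:Z) + p%:Z * k%:Z * (m%:Z - 2 * c));
    first by rewrite /c; ring.
  by rewrite E; ring.
- transitivity (s%:Z * k%:Z - p%:Z * k%:Z * c);
    first by rewrite /c; ring.
  by rewrite E; ring.
Qed.

Theorem theorem1p8 (n m j k s p r : nat) (hjm : (j <= m)%N) (hk : (1 <= k)%N)
    (hs : (1 <= s)%N) (hp : prime p) (hp3 : (3 <= p)%N)
    (hr : (1 <= r <= p - 1)%N)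
    (hnr : ~ exists x : nat, (x ^ 2 = r %[mod p])%N)
    (hsk : (s * k = 1 %[mod p])%N) :
  (bbar k (p%:Z * (m%:Z - j%:Z) + p%:Z - s%:Z) (p * m + s)%N (p * n + r)%N
     = 0 %[mod p%:Z])%Z.
Proof.
have Esk : (s * k = s * k %/ p * p + 1)%N.
  by rewrite {1}(divn_eq (s * k) p) hsk modn_small // prime_gt1.
have [H EH] := overcolored_gf_theta m j Esk.
apply/eqP; rewrite eqz_mod_dvd subr0 bbar_gf EH coef_fpsM.
apply: rpred_sum => i _.
(* If i = x^2, then p does not divide pn + r - i, since r would be a square modulo p; so the
   coefficient of H^p is divisible by p. Otherwise the theta coefficient vanishes. *)
have [/existsP[x /eqP ix]|nsq] := boolP [exists x : 'I_i.+1, i == x ^ 2 :> nat]%N.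
  apply/dvdz_mull/coef_fps_expp => //; apply/negP => /dvdnP[q Eq].
  case: hnr; exists x; rewrite -ix.
  have ein : (p * n + r = q * p + i)%N by rewrite -Eq subnK // -ltnS.
  by rewrite -(modnMDl q) -ein mulnC modnMDl.
rewrite theta_support ?mul0r ?dvdz0 // => x ix.
(* A square root of i is at most i, so the bounded search has covered it. *)
have xi : (x < i.+1)%N by nia.
by case/existsP: nsq; exists (Ordinal xi); apply/eqP.
Qed.
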